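(* Consider the measurement model $\mathbf{y}=\mathbf{g}(\mathbf{L},\mathbf{x})+\mathbf{w}$ described in the context, with $\mathbf{C}_{\mathbf{y}\mathbf{y}}$ and $\mathbf{D}_{\tilde{\mathbf{y}}\tilde{\mathbf{y}}}$ non-singular. Suppose that: (C.1) the measurement function is separable in the graph frequency domain: writing $\tilde{\mathbf{g}}(\mathbf{L},\mathbf{x})=\mathbf{V}^T\mathbf{g}(\mathbf{L},\mathbf{x})$, $$[\tilde{\mathbf{g}}(\mathbf{L},\mathbf{x})]_n=[\tilde{\mathbf{g}}(\mathbf{L},\tilde{x}_n\mathbf{v}_n)]_n,\qquad n=1,\dots,N,$$ where $\tilde{x}_n$ is the $n$th element of $\tilde{\mathbf{x}}=\mathbf{V}^T\mathbf{x}$ and $\mathbf{v}_n$ is the $n$th column of $\mathbf{V}$; (C.2) the elements $\tilde{x}_1,\dots,\tilde{x}_N$ of the input graph signal in the graph frequency domain are statistically independent; (C.3) the noise is uncorrelated in the graph frequency domain, i.e. $\mathbf{C}_{\tilde{\mathbf{w}}\tilde{\mathbf{w}}}$ is a diagonal matrix, where $\tilde{\mathbf{w}}=\mathbf{V}^T\mathbf{w}$. Then the GSP-LMMSE estimator coincides with the LMMSE estimator, i.e. $\hat{\mathbf{x}}^{(\mathrm{GSP\text{-}LMMSE})}=\hat{\mathbf{x}}^{(\mathrm{LMMSE})}$ as functions of $\mathbf{y}$.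
   Context: Graph: $\mathcal{G}$ is an undirected connected weighted graph on $N$ vertices with symmetric non-negative weighted adjacency matrix $\mathbf{W}\in\mathbb{R}^{N\times N}$ and Laplacian $\mathbf{L}=\mathrm{diag}(\mathbf{W}\mathbf{1})-\mathbf{W}$. Its eigenvalue decomposition is $\mathbf{L}=\mathbf{V}\boldsymbol{\Lambda}\mathbf{V}^T$, where $\boldsymbol{\Lambda}$ is diagonal with $0=\lambda_1<\lambda_2\le\dots\le\lambda_N$ and $\mathbf{V}$ is orthogonal ($\mathbf{V}^T=\mathbf{V}^{-1}$). The graph Fourier transform (GFT) of $\mathbf{a}\in\mathbb{R}^N$ is $\tilde{\mathbf{a}}=\mathbf{V}^T\mathbf{a}$. Model: $\mathbf{y}=\mathbf{g}(\mathbf{L},\mathbf{x})+\mathbf{w}$, where $\mathbf{g}:\mathbb{R}^{N\times N}\times\mathbb{R}^N\to\mathbb{R}^N$ is a known (measurable) function, $\mathbf{x}$ is a random vector in $\mathbb{R}^N$, and $\mathbf{w}$ is a zero-mean random noise vector in $\mathbb{R}^N$ independent of $\mathbf{x}$; all random vectors ($\mathbf{x}$, $\mathbf{w}$, $\mathbf{g}(\mathbf{L},\mathbf{x})$) have finite second moments. Notation: $\mathbf{C}_{\mathbf{a}\mathbf{b}}=\mathbb{E}[(\mathbf{a}-\mathbb{E}[\mathbf{a}])(\mathbf{b}-\mathbb{E}[\mathbf{b}])^T]$. For a vector $\mathbf{a}$, $\mathrm{diag}(\mathbf{a})$ is the diagonal matrix with diagonal $\mathbf{a}$; for a matrix $\mathbf{A}$,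 $\mathrm{diag}(\mathbf{A})$ is the vector of its diagonal entries. Put $\mathbf{d}_{\tilde{\mathbf{x}}\tilde{\mathbf{y}}}=\mathrm{diag}(\mathbf{C}_{\tilde{\mathbf{x}}\tilde{\mathbf{y}}})$ and $\mathbf{D}_{\tilde{\mathbf{y}}\tilde{\mathbf{y}}}=\mathrm{diag}(\mathrm{diag}(\mathbf{C}_{\tilde{\mathbf{y}}\tilde{\mathbf{y}}}))$. Estimators: the LMMSE estimator minimizes $\mathbb{E}\|\hat{\mathbf{x}}-\mathbf{x}\|^2$ among affine functions of $\mathbf{y}$; when $\mathbf{C}_{\mathbf{y}\mathbf{y}}$ is non-singular it is $$\hat{\mathbf{x}}^{(\mathrm{LMMSE})}=\mathbb{E}[\mathbf{x}]+\mathbf{C}_{\mathbf{x}\mathbf{y}}\mathbf{C}_{\mathbf{y}\mathbf{y}}^{-1}(\mathbf{y}-\mathbb{E}[\mathbf{y}]).$$ The GSP-LMMSE estimator minimizes $\mathbb{E}\|\hat{\mathbf{x}}-\mathbf{x}\|^2$ among estimators $\hat{\mathbf{x}}=\mathbf{V}\mathbf{F}\mathbf{V}^T\mathbf{y}+\mathbf{b}$ with $\mathbf{F}$ a real diagonal $N\times N$ matrix and $\mathbf{b}\in\mathbb{R}^N$; when $\mathbf{D}_{\tilde{\mathbf{y}}\tilde{\mathbf{y}}}$ is non-singular it is $$\hat{\mathbf{x}}^{(\mathrm{GSP\text{-}LMMSE})}=\mathbb{E}[\mathbf{x}]+\mathbf{V}\,\mathrm{diag}(\mathbf{d}_{\tilde{\mathbf{x}}\tilde{\mathbf{y}}})\,\mathbf{D}_{\tilde{\mathbf{y}}\tilde{\mathbf{y}}}^{-1}\mathbf{V}^T(\mathbf{y}-\mathbb{E}[\mathbf{y}]).$$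 *)

(* Defs.v *)
From HB Require Import structures.
From mathcomp Require Import all_boot all_order all_algebra.
From mathcomp Require Import all_classical all_reals all_analysis.

Set Implicit Arguments.
Unset Strict Implicit.
Unset Printing Implicit Defensive.

Import Order.TTheory GRing.Theory Num.Theory.
Import numFieldNormedType.Exports.

Local Open Scope classical_set_scope.
Local Open Scope ring_scope.

(* The Borel sigma-algebra of R^(m x n), presented as the product one: it is
   generated by the preimages of Borel sets of R under the coordinate maps. *)
Definition mx_cylinder (R : realType) (m n : nat) : set (set 'M[R]_(m, n)) :=
  [set A | exists i j (B : set R),
     measurable B /\ A = (fun M : 'M[R]_(m, n) => M i j) @^-1` B].

HB.instance Definition _ (R : realType) (m n : nat) :=
  @isMeasurable.Build (sigma_display (@mx_cylinder R m n))
    'M[R]_(m, n) <<s @mx_cylinder R m n >>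
    (@sigma_algebra0 _ setT (@mx_cylinder R m n))
    (@sigma_algebraC _ (@mx_cylinder R m n))
    (@sigma_algebra_bigcup _ setT (@mx_cylinder R m n)).

Section graph.
Variables (R : realType) (N : nat).

(* Vertices are joined by an edge exactly when the weight is positive. *)
Definition weighted_graph (W : 'M[R]_N) : Prop :=
  [/\ W^T = W,
      forall i j, 0 <= W i j
    & forall i j, connect (fun k l => 0 < W k l) i j].

Definition laplacian (W : 'M[R]_N) : 'M[R]_N :=
  diag_mx (W *m const_mx 1 : 'cV_N)^T - W.

(* Indices are shifted: lam 0 i is the (i+1)-th eigenvalue, so that the last
   three conditions read 0 = lambda_1 < lambda_2 <= ... <= lambda_N. *)
Definition laplacian_evd (L V : 'M[R]_N) (lam : 'rV[R]_N) : Prop :=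
  [/\ V^T *m V = 1%:M, L = V *m diag_mx lam *m V^T &
    [/\ forall i : 'I_N, i = 0%N :> nat -> lam 0 i = 0,
        forall i : 'I_N, (0 < i)%N -> 0 < lam 0 i
      & forall i j : 'I_N, (i <= j)%N -> lam 0 i <= lam 0 j]].

Definition gft (V : 'M[R]_N) (a : 'cV[R]_N) : 'cV[R]_N := V^T *m a.

Definition diagv (A : 'M[R]_N) : 'rV[R]_N := \row_i A i i.

Definition sqnorm (a : 'cV[R]_N) : R := \sum_i a i 0 ^+ 2.

Definition gsp_separable (L V : 'M[R]_N)
    (g : 'M[R]_N -> 'cV[R]_N -> 'cV[R]_N) : Prop :=
  forall (u : 'cV[R]_N) (n : 'I_N),
    gft V (g L u) n 0 = gft V (g L (gft V u n 0 *: col n V)) n 0.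

Definition affine_estimator (f : 'cV[R]_N -> 'cV[R]_N) : Prop :=
  exists (A : 'M[R]_N) (b : 'cV[R]_N), forall u, f u = A *m u + b.

Definition gsp_estimator (V : 'M[R]_N) (f : 'cV[R]_N -> 'cV[R]_N) : Prop :=
  exists (F : 'rV[R]_N) (b : 'cV[R]_N),
    forall u, f u = V *m diag_mx F *m V^T *m u + b.

End graph.

Section random_vectors.
Context {d : measure_display} {T : measurableType d} {R : realType}.
Variable P : probability T R.

Definition indep_pair d1 d2 (T1 : measurableType d1) (T2 : measurableType d2)
    (X : T -> T1) (Y : T -> T2) : Prop :=
  forall (A : set T1) (B : set T2), measurable A -> measurable B ->
    P (X @^-1` A `&` Y @^-1` B) = (P (X @^-1` A) * P (Y @^-1` B))%E.

Definition mutually_indep (I : finType) (X : I -> T -> R) : Prop :=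
  forall (J : {set I}) (B : I -> set R), (forall i, measurable (B i)) ->
    P (\bigcap_(i in [set` J]) X i @^-1` B i) =
      (\prod_(i in J) P (X i @^-1` B i))%E.

Variable N : nat.
Implicit Types a b x y : T -> 'cV[R]_N.

Definition coordv a (i : 'I_N) : T -> R := fun t => a t i 0.

(* Lfun P 2 contains the measurable functions with a finite second moment. *)
Definition finite_second_moment a : Prop :=
  forall i, coordv a i \in Lfun P 2%:E.

Definition meanv a : 'cV[R]_N := \col_i fine ('E_P[coordv a i])%E.

Definition covmx a b : 'M[R]_N :=
  \matrix_(i, j) fine (covariance P (coordv a i) (coordv b j)).

Definition mse x y (f : 'cV[R]_N -> 'cV[R]_N) : \bar R :=
  ('E_P[(fun t => sqnorm (f (y t) - x t))])%E.

Definition is_best x y (C : ('cV[R]_N -> 'cV[R]_N) -> Prop)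
    (f : 'cV[R]_N -> 'cV[R]_N) : Prop :=
  C f /\ forall h, C h -> (mse x y f <= mse x y h)%E.

Definition is_lmmse x y := is_best x y (@affine_estimator R N).

Definition is_gsp_lmmse (V : 'M[R]_N) x y := is_best x y (gsp_estimator V).

Definition lmmse x y (u : 'cV[R]_N) : 'cV[R]_N :=
  meanv x + covmx x y *m invmx (covmx y y) *m (u - meanv y).

(* diag(d_x~y~); with both arguments equal to y this is D_y~y~. *)
Definition gft_dcov (V : 'M[R]_N) x y : 'M[R]_N :=
  diag_mx (diagv (covmx (gft V \o x) (gft V \o y))).

Definition gsp_lmmse (V : 'M[R]_N) x y (u : 'cV[R]_N) : 'cV[R]_N :=
  meanv x +
  V *m gft_dcov V x y *m invmx (gft_dcov V y y) *m V^T *m (u - meanv y).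

End random_vectors.

(* Main.v *)
(* In the graph frequency domain C1, C2 and the independence of x and w make
   the n-th entry of V^T y a function of the n-th entry of V^T x plus noise, so
   that both V^T C_xy V and V^T C_yy V are diagonal; hence the GSP-LMMSE gain A
   satisfies the normal equation A C_yy = C_xy of the LMMSE estimator.
   Each estimator is the unique minimizer in its class by Pythagoras: changing
   the optimal gain by B and the offset by c increases the mean square error by
   tr(C_{By,By}) + |B E[y] + c|^2, and tr(C_{By,By}) = 0 forces B C_yy = 0. *)
Require Import Defs.
From HB Require Import structures.
From mathcomp Require Import all_boot all_order all_algebra.
From mathcomp Require Import all_classical all_reals all_analysis.
From mathcomp Require Import measurable_realfun.

Set Implicit Arguments.
Unset Strict Implicit.
Unset Printing Implicit Defensive.

Import Order.TTheory GRing.Theory Num.Theory.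
Import numFieldNormedType.Exports.

Local Open Scope classical_set_scope.
Local Open Scope ring_scope.

(** * Independence and vanishing covariance *)

Section independence.
Context {d : measure_display} {T : measurableType d} {R : realType}.
Variable P : probability T R.

Lemma indep_pair_comp d1 d2 d3 d4 (T1 : measurableType d1)
    (T2 : measurableType d2) (T3 : measurableType d3) (T4 : measurableType d4)
    (X : T -> T1) (Y : T -> T2) (f : T1 -> T3) (h : T2 -> T4) :
  measurable_fun setT f -> measurable_fun setT h ->
  indep_pair P X Y -> indep_pair P (f \o X) (h \o Y).
Proof.
move=> mf mh XY A B mA mB; apply: (XY (f @^-1` A) (h @^-1` B)).
- by rewrite -[X in measurable X]setTI; exact: mf.
- by rewrite -[X in measurable X]setTI; exact: mh.
Qed.

Lemma mutually_indep_pair (I : finType) (X : I -> T -> R) (i j : I) :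
  i != j -> mutually_indep P X -> indep_pair P (X i) (X j).
Proof.
move=> ij iX A B mA mB.
(* The index set [{i, j}], with event [A] at [i] and [B] elsewhere, turns the product rule of the
   family into a two-event one. *)
have := iX [set i; j]%SET (fun k => if k == i then A else B).
rewrite big_setU1 ?inE//= big_set1 eqxx eq_sym (negbTE ij) => <-; last first.
  by move=> k; case: ifP.
congr (P _); apply/seteqP; split => t /=.
- move=> [At Bt] k /=; rewrite !inE; case: ifP => [/eqP ->//|_ /=].
  by move=> /eqP ->.
- move=> h; split.
  + by have := h i; rewrite /= !inE eqxx; apply.
  + by have := h j; rewrite /= !inE eqxx orbT eq_sym (negbTE ij); apply.
Qed.

(** Independence makes the law of the pair agree with the product of the laws on rectangles, hence
    everywhere by uniqueness of the product measure; Fubini then splits the integral. *)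
Lemma integral_indep_pair d1 d2 (T1 : measurableType d1)
    (T2 : measurableType d2) (X : {RV P >-> T1}) (Y : {RV P >-> T2})
    (f : T1 * T2 -> \bar R) :
  indep_pair P X Y -> measurable_fun setT f ->
  P.-integrable setT (fun t => f (X t, Y t)) ->
  (\int[P]_t f (X t, Y t) =
   \int[distribution P X]_u \int[distribution P Y]_v f (u, v))%E.
Proof.
move=> XY mf fXY.
pose Z := fun t => (X t, Y t).
have mZ : measurable_fun setT Z by exact: measurable_fun_pair.
pose mZ_ := isMeasurableFun.Build _ _ _ _ Z mZ.
pose rZ : {RV P >-> (T1 * T2)%type} := HB.pack Z mZ_.
have mE A : measurable A ->
    (distribution P X \x distribution P Y)%E A = distribution P rZ A.
  apply: product_measure_unique => B C mB mC; exact: XY.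
have intE h : (\int[(distribution P X \x distribution P Y)%E]_z h z =
    \int[distribution P rZ]_z h z)%E.
  by apply: eq_measure_integral => A mA _; exact: mE.
rewrite -[LHS](integral_distribution (X := rZ) mf fXY) -intE.
rewrite -integral12_prod_meas1//.
(* Fubini needs integrability under the product law; it is inherited from [P] by transporting the
   integral of the absolute value. *)
apply/integrableP; split => //.
rewrite intE ge0_integral_distribution//; last exact: measurableT_comp.
by have /integrableP[] := fXY.
Qed.

(** Fubini for [f (u, v) = u * v]: the inner integral is [u] times the mean of [Y], and finiteness
    of that mean lets it leave the outer integral. *)
Lemma expectation_indep_prod (X Y : {RV P >-> R}) :
    indep_pair P X Y -> (X : T -> R) \in Lfun P 1 ->
    (Y : T -> R) \in Lfun P 1 ->
    (X \* Y) \in Lfun P 1 ->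
  ('E_P[X \* Y] = 'E_P[X] * 'E_P[Y])%E.
Proof.
move=> XY X1 Y1 XY1.
have idint (V : {RV P >-> R}) : (V : T -> R) \in Lfun P 1 ->
    (distribution P V).-integrable setT (EFin : R -> \bar R).
  by move=> V1; apply: integrable_pushforward => //; exact/Lfun1_integrable.
have EE (V : {RV P >-> R}) : (V : T -> R) \in Lfun P 1 ->
    (\int[distribution P V]_v v%:E = 'E_P[V])%E.
  move=> V1; rewrite expectation_def.
  apply: (@integral_distribution _ _ _ _ _ _ V EFin) => //.
  exact/Lfun1_integrable.
pose f (z : R * R) := (z.1 * z.2)%:E.
have mf : measurable_fun setT f.
  by apply/measurable_EFinP; exact: measurable_funM.
rewrite {1}expectation.unlock.
rewrite (integral_indep_pair (f := f) XY mf) /f/=; last exact/Lfun1_integrable.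
under eq_integral => u _.
  under eq_integral => v _ do rewrite EFinM.
  rewrite integralZl//; last exact: idint.
  rewrite EE//.
  over.
have Yfin := expectation_fin_num Y1.
by rewrite -(fineK Yfin) integralZr ?EE//; exact: idint.
Qed.

Lemma covariance_indep (X Y : T -> R) :
    X \in Lfun P 2%:E -> Y \in Lfun P 2%:E -> indep_pair P X Y ->
  covariance P X Y = 0%E.
Proof.
move=> X2 Y2 XY.
have Pfin : P setT \is a fin_num := fin_num_measure P _ measurableT.
have X1 := Lfun_subset12 Pfin X2.
have Y1 := Lfun_subset12 Pfin Y2.
have XY1 := Lfun2_mul_Lfun1 X2 Y2.
have mX : measurable_fun setT X by exact: set_mem (sub_Lfun_mfun X1).
have mY : measurable_fun setT Y by exact: set_mem (sub_Lfun_mfun Y1).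
pose mX_ := isMeasurableFun.Build _ _ _ _ X mX.
pose rX : {RV P >-> R} := HB.pack X mX_.
pose mY_ := isMeasurableFun.Build _ _ _ _ Y mY.
pose rY : {RV P >-> R} := HB.pack Y mY_.
rewrite covarianceE//.
rewrite (@expectation_indep_prod rX rY)//.
by rewrite subee// fin_numM// expectation_fin_num.
Qed.

End independence.

(** * Measurability of matrix-valued maps, coordinate by coordinate *)

Section matrix_measurability.
Context {R : realType} {m n : nat}.

Lemma measurable_mx_coord (i : 'I_m) (j : 'I_n) :
  measurable_fun setT (fun M : 'M[R]_(m, n) => M i j).
Proof.
move=> _ B mB; rewrite setTI; apply: sub_sigma_algebra.
by exists i, j, B.
Qed.

Lemma measurable_fun_mx d (T : measurableType d) (f : T -> 'M[R]_(m, n)) :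
  (forall i j, measurable_fun setT (fun t => f t i j)) ->
  measurable_fun setT f.
Proof.
move=> mf; apply: (@measurability _ _ _ _ _ _ (@mx_cylinder R m n)) => //.
by move=> _ [A [i [j [B [mB ->]]]] <-]; exact: mf.
Qed.

Lemma measurable_mulmx_coord p (A : 'M[R]_(p, m)) i j :
  measurable_fun setT (fun M : 'M[R]_(m, n) => (A *m M) i j).
Proof.
under eq_fun do rewrite mxE.
apply: measurable_sum => k; apply: measurable_funM => //.
exact: measurable_mx_coord.
Qed.

End matrix_measurability.

(** * Means and covariances of square-integrable real variables *)

Section second_order.
Context {d : measure_display} {T : measurableType d} {R : realType}.
Variable P : probability T R.
Implicit Types X Y Z : T -> R.

Local Notation ex X := (fine (expectation P X)).
Local Notation cov X Y := (fine (covariance P X Y)).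

Lemma Lfun2_Lfun1 X : X \in Lfun P 2%:E -> X \in Lfun P 1.
Proof. by apply: Lfun_subset12; exact: fin_num_measure. Qed.

Lemma Lfun2D X Y : X \in Lfun P 2%:E -> Y \in Lfun P 2%:E ->
  X \+ Y \in Lfun P 2%:E.
Proof.
have le12 : (1 <= 2%:E :> \bar R)%E by rewrite lee_fin ler1n.
exact: (Lfun_addr_closed P le12).2.
Qed.

Lemma Lfun2_sumZ (I : Type) (r : seq I) (c : I -> R) (X : I -> T -> R) :
  (forall i, X i \in Lfun P 2%:E) ->
  (fun t => \sum_(i <- r) c i * X i t) \in Lfun P 2%:E.
Proof.
move=> X2; elim: r => [|i r IHr].
  by under eq_fun do rewrite big_nil; exact: Lfun_cst.
under eq_fun do rewrite big_cons mulrC.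
by apply: Lfun2D => //; apply: Lfun_scale => //; rewrite ler1n.
Qed.

Lemma covariance_Lfun2_fin_num X Y :
    X \in Lfun P 2%:E -> Y \in Lfun P 2%:E ->
  covariance P X Y \is a fin_num.
Proof.
move=> X2 Y2; apply: covariance_fin_num; [exact: Lfun2_Lfun1..|].
exact: Lfun2_mul_Lfun1.
Qed.

Lemma fine_expectationD X Y : X \in Lfun P 1 -> Y \in Lfun P 1 ->
  ex (X \+ Y) = ex X + ex Y.
Proof. by move=> X1 Y1; rewrite expectationD// fineD// expectation_fin_num. Qed.

Lemma fine_expectation_sumZ (I : Type) (r : seq I) (c : I -> R)
    (X : I -> T -> R) : (forall i, X i \in Lfun P 2%:E) ->
  ex (fun t => \sum_(i <- r) c i * X i t) = \sum_(i <- r) c i * ex (X i).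
Proof.
move=> X2; elim: r => [|i r IHr].
  by under eq_fun do rewrite big_nil; rewrite expectation_cst big_nil.
under eq_fun do rewrite big_cons mulrC.
rewrite fine_expectationD ?Lfun2_Lfun1//; last 2 first.
- by apply: Lfun_scale => //; rewrite ler1n.
- exact: Lfun2_sumZ.
rewrite IHr big_cons expectationZl ?Lfun2_Lfun1// fineM//.
by rewrite expectation_fin_num// Lfun2_Lfun1.
Qed.

Lemma fine_covarianceDl X Y Z : X \in Lfun P 2%:E -> Y \in Lfun P 2%:E ->
  Z \in Lfun P 2%:E -> cov (X \+ Y) Z = cov X Z + cov Y Z.
Proof.
by move=> X2 Y2 Z2; rewrite covarianceDl// fineD// covariance_Lfun2_fin_num.
Qed.

Lemma fine_covariance_sumZl (I : Type) (r : seq I) (c : I -> R)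
    (X : I -> T -> R) Y :
    (forall i, X i \in Lfun P 2%:E) -> Y \in Lfun P 2%:E ->
  cov (fun t => \sum_(i <- r) c i * X i t) Y = \sum_(i <- r) c i * cov (X i) Y.
Proof.
move=> X2 Y2; elim: r => [|i r IHr].
  by under eq_fun do rewrite big_nil; rewrite covariance_cst_l big_nil.
under eq_fun do rewrite big_cons mulrC.
rewrite fine_covarianceDl//; last 2 first.
- by apply: Lfun_scale => //; rewrite ler1n.
- exact: Lfun2_sumZ.
rewrite IHr big_cons covarianceZl ?Lfun2_mul_Lfun1 ?Lfun2_Lfun1//.
by rewrite fineM// covariance_Lfun2_fin_num.
Qed.

(** Cauchy-Schwarz bounds the covariance of [X] with [Y] and with [- Y] above by zero, which gives
    both inequalities. *)
Lemma fine_covariance_var0 X Y : X \in Lfun P 2%:E -> Y \in Lfun P 2%:E ->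
  cov X X = 0 -> cov X Y = 0.
Proof.
move=> X2 Y2 X0.
have VX : (variance P X = 0)%E by rewrite -(fineK (variance_fin_num X2)) X0.
have cov_le0 Z : Z \in Lfun P 2%:E -> cov X Z <= 0.
  move=> Z2; rewrite -lee_fin fineK ?covariance_Lfun2_fin_num//.
  by rewrite (le_trans (covariance_le X2 Z2))// VX sqrte0 mul0e.
apply/eqP; rewrite eq_le cov_le0//= -oppr_le0 -fineN.
rewrite -covarianceNr ?Lfun2_mul_Lfun1 ?Lfun2_Lfun1//.
exact: cov_le0 (Lfun_oppr_closed Y2).
Qed.

Lemma expectation_sqr X : X \in Lfun P 2%:E ->
  ('E_P[X ^+ 2])%E = (cov X X + ex X ^+ 2)%:E.
Proof.
move=> X2; have := varianceE X2; rewrite /variance.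
have XX1 : X ^+ 2 \in Lfun P 1 by rewrite expr2; exact: Lfun2_mul_Lfun1.
have := expectation_fin_num XX1; have := expectation_fin_num (Lfun2_Lfun1 X2).
by move=> /fineK <- /fineK <- ->; rewrite -EFin_expe -EFinB/= subrK.
Qed.

End second_order.

(** * Mean vectors and covariance matrices *)

Section random_vectors.
Context {d : measure_display} {T : measurableType d} {R : realType}.
Variables (P : probability T R) (N : nat).
Implicit Types a b c : T -> 'cV[R]_N.

Local Notation L2 := (@finite_second_moment _ _ _ P N).

Lemma finite_second_momentD a b : L2 a -> L2 b -> L2 (fun t => a t + b t).
Proof.
move=> a2 b2 i; rewrite /coordv; under eq_fun do rewrite mxE.
exact: Lfun2D (a2 i) (b2 i).
Qed.

Lemma finite_second_moment_cst (u : 'cV[R]_N) : L2 (fun=> u).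
Proof. by move=> i; exact: Lfun_cst. Qed.

Lemma finite_second_moment_mulmx (A : 'M[R]_N) a :
  L2 a -> L2 (fun t => A *m a t).
Proof.
move=> a2 i; rewrite /coordv; under eq_fun do rewrite mxE.
exact: (Lfun2_sumZ _ (A i) a2).
Qed.

Lemma meanvD a b : L2 a -> L2 b ->
  meanv P (fun t => a t + b t) = meanv P a + meanv P b.
Proof.
move=> a2 b2; apply/colP => i; rewrite !mxE /coordv.
under eq_fun do rewrite mxE.
exact: fine_expectationD (Lfun2_Lfun1 (a2 i)) (Lfun2_Lfun1 (b2 i)).
Qed.

Lemma meanv_cst (u : 'cV[R]_N) : meanv P (fun=> u) = u.
Proof. by apply/colP => i; rewrite !mxE /coordv expectation_cst. Qed.

Lemma meanv_mulmx (A : 'M[R]_N) a : L2 a ->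
  meanv P (fun t => A *m a t) = A *m meanv P a.
Proof.
move=> a2; apply/colP => i; rewrite !mxE /coordv.
under eq_fun do rewrite mxE.
rewrite (fine_expectation_sumZ _ (A i) a2).
by apply: eq_bigr => j _; rewrite mxE.
Qed.

Lemma trmx_covmx a b : (covmx P a b)^T = covmx P b a.
Proof. by apply/matrixP => i j; rewrite !mxE covarianceC. Qed.

Lemma covmxDl a b c : L2 a -> L2 b -> L2 c ->
  covmx P (fun t => a t + b t) c = covmx P a c + covmx P b c.
Proof.
move=> a2 b2 c2; apply/matrixP => i j; rewrite !mxE /coordv.
under [X in covariance P X]eq_fun do rewrite mxE.
exact: fine_covarianceDl (a2 i) (b2 i) (c2 j).
Qed.

Lemma covmxDr a b c : L2 a -> L2 b -> L2 c ->
  covmx P a (fun t => b t + c t) = covmx P a b + covmx P a c.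
Proof.
by move=> *; rewrite -trmx_covmx covmxDl// linearD/= !trmx_covmx.
Qed.

Lemma covmx_cstl (u : 'cV[R]_N) b : covmx P (fun=> u) b = 0.
Proof. by apply/matrixP => i j; rewrite !mxE covariance_cst_l. Qed.

Lemma covmx_cstr a (u : 'cV[R]_N) : covmx P a (fun=> u) = 0.
Proof. by rewrite -trmx_covmx covmx_cstl trmx0. Qed.

Lemma covmx_addcl (u : 'cV[R]_N) a b : L2 a -> L2 b ->
  covmx P (fun t => a t + u) b = covmx P a b.
Proof.
move=> a2 b2; rewrite (covmxDl a2 (finite_second_moment_cst u) b2).
by rewrite covmx_cstl addr0.
Qed.

Lemma covmx_addcr (u : 'cV[R]_N) a b : L2 a -> L2 b ->
  covmx P a (fun t => b t + u) = covmx P a b.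
Proof. by move=> *; rewrite -trmx_covmx covmx_addcl// trmx_covmx. Qed.

Lemma covmx_sqrD a b : L2 a -> L2 b ->
  covmx P (fun t => a t + b t) (fun t => a t + b t) =
  covmx P a a + (covmx P a b + (covmx P a b)^T) + covmx P b b.
Proof.
move=> a2 b2; have ab2 := finite_second_momentD a2 b2.
rewrite (covmxDl a2 b2 ab2) (covmxDr a2 a2 b2) (covmxDr b2 a2 b2).
by rewrite trmx_covmx !addrA.
Qed.

Lemma covmx_mull (A : 'M[R]_N) a b : L2 a -> L2 b ->
  covmx P (fun t => A *m a t) b = A *m covmx P a b.
Proof.
move=> a2 b2; apply/matrixP => i j; rewrite !mxE /coordv.
under [X in covariance P X]eq_fun do rewrite mxE.
rewrite (fine_covariance_sumZl _ (A i) a2 (b2 j)).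
by apply: eq_bigr => k _; rewrite mxE.
Qed.

Lemma covmx_mulr (A : 'M[R]_N) a b : L2 a -> L2 b ->
  covmx P a (fun t => A *m b t) = covmx P a b *m A^T.
Proof.
by move=> *; rewrite -trmx_covmx covmx_mull// trmx_mul trmx_covmx.
Qed.

Lemma mxtrace_covmx_ge0 a : 0 <= \tr (covmx P a a).
Proof.
apply: sumr_ge0 => i _; rewrite mxE fine_ge0//.
exact: variance_ge0.
Qed.

(** The trace is a sum of variances, so each of them is zero, and a variable of variance zero is
    uncorrelated with every other. *)
Lemma covmx_mxtrace0 a b : L2 a -> L2 b ->
  \tr (covmx P a a) = 0 -> covmx P a b = 0.
Proof.
move=> a2 b2 /psumr_eq0P aa0; apply/matrixP => i j; rewrite !mxE.
apply: fine_covariance_var0 => //.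
have := aa0 _ i isT; rewrite mxE; apply => k _; rewrite mxE fine_ge0//.
exact: variance_ge0.
Qed.

(** Sums the identity [E[X^2] = Var X + (E X)^2] over the coordinates; applied to an estimation
    error it expresses the mean square error through second-order data. *)
Lemma expectation_sqnorm a : L2 a ->
  ('E_P[fun t => sqnorm (a t)])%E =
  (\tr (covmx P a a) + sqnorm (meanv P a))%:E.
Proof.
move=> a2; rewrite /sqnorm /mxtrace -big_split/= -sumEFin.
have -> : (fun t => \sum_i a t i 0 ^+ 2) =
    \sum_(X <- [seq coordv a i ^+ 2 | i <- index_enum 'I_N]) X.
  by apply/funext => t; rewrite big_map fct_sumE.
rewrite expectation_sum => [|_ /mapP[i _ ->]]; last first.
  by rewrite expr2; exact: Lfun2_mul_Lfun1.
rewrite big_map; apply: eq_bigr => i _.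
by rewrite expectation_sqr// !mxE.
Qed.

End random_vectors.

(** * Minimizers of the mean square error among affine estimators *)

Section best_estimators.
Context {d : measure_display} {T : measurableType d} {R : realType}.
Variables (P : probability T R) (N : nat).
Implicit Types x y : T -> 'cV[R]_N.

Local Notation L2 := (@finite_second_moment _ _ _ P N).

Lemma sqnorm_ge0 (u : 'cV[R]_N) : 0 <= sqnorm u.
Proof. by apply: sumr_ge0 => i _; exact: sqr_ge0. Qed.

Lemma sqnorm0 : sqnorm (0 : 'cV[R]_N) = 0.
Proof. by rewrite /sqnorm big1// => i _; rewrite mxE expr0n. Qed.

Lemma sqnorm_eq0 (u : 'cV[R]_N) : sqnorm u = 0 -> u = 0.
Proof.
move=> /psumr_eq0P u0; apply/colP => i; apply/eqP; rewrite mxE -sqrf_eq0.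
by rewrite u0// => j _; exact: sqr_ge0.
Qed.

Section fixed_signals.
Variables (x y : T -> 'cV[R]_N).
Hypotheses (x2 : L2 x) (y2 : L2 y).

Let resid (A : 'M[R]_N) (b : 'cV[R]_N) t := A *m y t + b - x t.

(** Writing [- x] as a matrix multiple lets the rules for sums and for [*m] handle the whole
    error. *)
Let residE A b : resid A b = fun t => A *m y t + b + (- 1%:M) *m x t.
Proof. by apply/funext => t; rewrite mulNmx mul1mx. Qed.

Let Ay2 (A : 'M[R]_N) : L2 (fun t => A *m y t).
Proof. exact: finite_second_moment_mulmx. Qed.

Let Ayb2 (A : 'M[R]_N) (b : 'cV[R]_N) : L2 (fun t => A *m y t + b).
Proof.
by apply: finite_second_momentD => //; exact: finite_second_moment_cst.
Qed.

Let Nx2 : L2 (fun t => (- 1%:M) *m x t).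
Proof. exact: finite_second_moment_mulmx. Qed.

Let resid2 A b : L2 (resid A b).
Proof. by rewrite residE; exact: finite_second_momentD. Qed.

Let meanv_resid A b : meanv P (resid A b) = A *m meanv P y + b - meanv P x.
Proof.
rewrite residE meanvD// meanvD//; last exact: finite_second_moment_cst.
by rewrite meanv_cst !meanv_mulmx// mulNmx mul1mx.
Qed.

Let covmx_resid A b : covmx P y (resid A b) = covmx P y y *m A^T - covmx P y x.
Proof.
rewrite residE covmxDr// covmxDr//; last exact: finite_second_moment_cst.
by rewrite covmx_cstr addr0 !covmx_mulr// linearN/= trmx1 mulmxN mulmx1.
Qed.

(** The new error is [(B y + c) + resid A b]. The first hypothesis makes the old error centered, the
    second makes the trace of the cross-covariance vanish, so only the two square terms remain. *)
Lemma mse_pythagoras (A B : 'M[R]_N) (b c : 'cV[R]_N) :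
    A *m meanv P y + b = meanv P x ->
    \tr (B *m (covmx P y y *m A^T - covmx P y x)) = 0 ->
  mse P x y (fun u => (A + B) *m u + (b + c)) =
  (mse P x y (fun u => A *m u + b)%R +
   (\tr (covmx P (fun t => B *m y t) (fun t => B *m y t)) +
    sqnorm (B *m meanv P y + c))%:E)%E.
Proof.
move=> mA BC; rewrite /mse.
have mr0 : meanv P (resid A b) = 0 by rewrite meanv_resid mA subrr.
have -> : (fun t => sqnorm ((A + B) *m y t + (b + c) - x t)) =
    (fun t => sqnorm (B *m y t + c + resid A b t)).
  apply/funext => t; congr sqnorm; rewrite /resid mulmxDl.
  by rewrite addrACA [X in X - _]addrC [RHS]addrA.
rewrite expectation_sqnorm; last exact: finite_second_momentD.
rewrite [in RHS](expectation_sqnorm (resid2 A b)).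
rewrite meanvD// mr0 addr0 meanvD//; last exact: finite_second_moment_cst.
rewrite meanv_cst meanv_mulmx//.
set r := resid A b.
have c2 : L2 (fun=> c) by exact: finite_second_moment_cst.
have Bc2 := Ayb2 B c.
have r2 : L2 r := resid2 A b.
have Byr : covmx P (fun t => B *m y t) r =
    B *m (covmx P y y *m A^T - covmx P y x).
  by rewrite covmx_mull// covmx_resid.
rewrite (covmx_sqrD Bc2 r2) covmx_addcl// covmx_addcr// covmx_addcl//.
rewrite !linearD/= mxtrace_tr Byr BC !addr0 -EFinD.
by rewrite sqnorm0 addr0 addrCA addrA.
Qed.

(** Treats both estimators at once: [S] is the linear constraint on the gain. The trace condition is
    the orthogonality of the optimal error to admissible gains applied to [y]; the last condition
    says that the covariance of [y] is non-degenerate on [S], which gives uniqueness. *)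
Lemma is_best_affine (C : ('cV[R]_N -> 'cV[R]_N) -> Prop)
    (S : 'M[R]_N -> Prop) (A : 'M[R]_N) :
    (forall f, C f <-> exists B b, S B /\ forall u, f u = B *m u + b) ->
    S A -> (forall B, S B -> S (B - A)) ->
    (forall B, S B -> \tr (B *m (covmx P y y *m A^T - covmx P y x)) = 0) ->
    (forall B, S B -> B *m covmx P y y = 0 -> B = 0) ->
  forall f, is_best P x y C f <->
            f = fun u => meanv P x + A *m (u - meanv P y).
Proof.
move=> CE SA SB orth def f.
set f0 := fun u => _ + _.
(* The offset that makes the error centered. *)
pose b := meanv P x - A *m meanv P y.
have f0E : f0 = fun u => A *m u + b.
  by apply/funext => u; rewrite /f0 mulmxBr addrCA.
have mA : A *m meanv P y + b = meanv P x by rewrite /b addrC subrK.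
have Cf0 : C f0 by apply/CE; exists A, b; split => // u; rewrite f0E.
(* Every competitor is the candidate perturbed by gain [B - A] and offset [c - b]. The trace
   condition for [B - A] comes from closure of [S] under subtracting [A]. *)
have mseE h B c : S B -> (forall u, h u = B *m u + c) ->
    mse P x y h = (mse P x y f0 +
     (\tr (covmx P (fun t => (B - A) *m y t) (fun t => (B - A) *m y t)) +
      sqnorm ((B - A) *m meanv P y + (c - b)))%:E)%E.
  move=> SBB hE; rewrite f0E -mse_pythagoras//; last exact/orth/SB.
  by congr mse; apply/funext => u; rewrite hE !subrKC.
(* Finiteness allows cancelling this term between extended reals below. *)
have mse0 : mse P x y f0 \is a fin_num.
  by rewrite f0E /mse (expectation_sqnorm (resid2 A b)).
split=> [[/CE[B [c [SBB fE]]] fmin]|->]; last first.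
  split=> // h /CE[B [c [SBB hE]]]; rewrite (mseE _ _ _ SBB hE) leeDl// lee_fin.
  by rewrite addr_ge0 ?sqnorm_ge0 ?mxtrace_covmx_ge0.
have := fmin _ Cf0; rewrite (mseE _ _ _ SBB fE) -[leRHS]adde0 leeD2lE// lee_fin.
set tr := \tr _; set sq := sqnorm _ => le0.
have tr_ge0 : 0 <= tr by exact: mxtrace_covmx_ge0.
have sq_ge0 : 0 <= sq by exact: sqnorm_ge0.
have /eqP : tr + sq = 0 by apply/eqP; rewrite eq_le le0 addr_ge0.
rewrite paddr_eq0// => /andP[/eqP tr0 /eqP/sqnorm_eq0].
(* Trace zero makes [(B - A) y] uncorrelated with [y], that is, [(B - A) *m covmx P y y = 0]. *)
have BA : B - A = 0.
  apply: def; first exact: SB.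
  by rewrite -covmx_mull//; exact: covmx_mxtrace0.
rewrite BA mul0mx add0r => /subr0_eq cb.
by apply/funext => u; rewrite fE f0E cb (subr0_eq BA).
Qed.

End fixed_signals.
End best_estimators.

(** * Diagonal matrices *)

Section diagonal_matrices.
Context {R : realType} {N : nat}.

Lemma diag_mx_unit (v : 'rV[R]_N) i : diag_mx v \in unitmx -> v 0 i != 0.
Proof. by rewrite unitmxE det_diag unitfE => /prodf_neq0; apply. Qed.

Lemma invmx_diag (v : 'rV[R]_N) : diag_mx v \in unitmx ->
  invmx (diag_mx v) = diag_mx (\row_i (v 0 i)^-1).
Proof.
move=> vU; rewrite -[RHS](mulKmx vU) mulmx_diag -[invmx _ in LHS]mulmx1.
congr (_ *m _); apply/matrixP => i j; rewrite !mxE.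
by rewrite mulfV// diag_mx_unit.
Qed.

Lemma is_diag_diagv (A : 'M[R]_N) : is_diag_mx A -> A = diag_mx (diagv A).
Proof.
move=> /is_diag_mxP dA; apply/matrixP => i j; rewrite !mxE.
by have [->//|ij] := eqVneq i j; rewrite mulr0n dA.
Qed.

Lemma mxtrace_diag_mull (v : 'rV[R]_N) (A : 'M[R]_N) :
  \tr (diag_mx v *m A) = \sum_i v 0 i * A i i.
Proof. by apply: eq_bigr => i _; rewrite mul_diag_mx mxE. Qed.

End diagonal_matrices.

(** * The two closed-form estimators and the graph Fourier transform *)

Section gsp.
Context {d : measure_display} {T : measurableType d} {R : realType}.
Variables (P : probability T R) (N : nat) (V : 'M[R]_N).
Hypothesis VTV : V^T *m V = 1%:M.
Implicit Types x y : T -> 'cV[R]_N.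

Local Notation L2 := (@finite_second_moment _ _ _ P N).

Let VVT : V *m V^T = 1%:M. Proof. exact: mulmx1C. Qed.

Lemma covmx_gft x y : L2 x -> L2 y ->
  covmx P (gft V \o x) (gft V \o y) = V^T *m covmx P x y *m V.
Proof.
move=> x2 y2; rewrite covmx_mull//; last exact: finite_second_moment_mulmx.
by rewrite covmx_mulr// trmxK mulmxA.
Qed.

Lemma is_lmmseE x y : L2 x -> L2 y -> covmx P y y \in unitmx ->
  forall f, is_lmmse P x y f <-> f = lmmse P x y.
Proof.
move=> x2 y2 yU f.
apply: (is_best_affine x2 y2 (S := fun=> True)) => //.
- move=> h; split=> [[A [b hE]]|[A [b [_ hE]]]]; first by exists A, b.
  by exists A, b.
(* By symmetry of the covariance of [y], the gain solves the normal equation, so the whole factor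
   multiplying [B] is zero. *)
- move=> B _; rewrite trmx_mul trmx_inv !trmx_covmx mulmxA mulmxV// mul1mx.
  by rewrite subrr mulmx0 mxtrace0.
- by move=> B _ By0; rewrite -[B](mulmxK yU) By0 mul0mx.
Qed.

(** In the graph frequency domain a diagonal gain meets only the diagonal of the normal equation,
    which splits into [N] scalar equations with non-zero coefficients [Cy i i]. *)
Lemma is_gsp_lmmseE x y : L2 x -> L2 y -> gft_dcov P V y y \in unitmx ->
  forall f, is_gsp_lmmse P V x y f <-> f = gsp_lmmse P V x y.
Proof.
move=> x2 y2 DU f.
set A := V *m gft_dcov P V x y *m invmx (gft_dcov P V y y) *m V^T.
pose Cx := covmx P (gft V \o x) (gft V \o y).
pose Cy := covmx P (gft V \o y) (gft V \o y).
have Dy_neq0 i : Cy i i != 0.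
  by have := diag_mx_unit i DU; rewrite mxE.
pose F0 : 'rV[R]_N := \row_i (Cx i i * (Cy i i)^-1).
have AE : A = V *m diag_mx F0 *m V^T.
  rewrite /A -(mulmxA V) invmx_diag// mulmx_diag; congr (_ *m diag_mx _ *m _).
  by apply/rowP => i; rewrite !mxE.
apply: (is_best_affine x2 y2 (A := A)
  (S := fun B => exists F, B = V *m diag_mx F *m V^T)) => //.
- move=> h; split=> [[F [b hE]]|[_ [b [[F ->] hE]]]]; last by exists F, b.
  by exists (V *m diag_mx F *m V^T), b; split => //; exists F.
- by exists F0.
- move=> _ [F ->]; exists (F - F0).
  by rewrite AE -mulmxBl -mulmxBr [diag_mx (F - F0)]raddfB.
(* Cyclicity of the trace moves the left factor [V] to the far right, leaving [diag_mx F] times a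
   matrix conjugated into the frequency domain. *)
- move=> _ [F ->]; rewrite -!mulmxA mxtrace_mulC -!mulmxA AE.
  rewrite mxtrace_diag_mull big1// => i _.
  have -> :
      V^T *m ((covmx P y y *m (V *m diag_mx F0 *m V^T)^T - covmx P y x) *m V) =
      Cy *m diag_mx F0 - Cx^T.
    rewrite /Cy /Cx trmx_covmx !covmx_gft// !trmx_mul trmxK tr_diag_mx.
    rewrite mulmxBl mulmxBr -!mulmxA VTV mulmx1.
    by rewrite !mulmxA.
  move: (Dy_neq0 i); rewrite /F0; clearbody Cx Cy => Cy0.
  by rewrite mul_mx_diag !mxE mulrCA mulfV// mulr1 subrr mulr0.
- move=> _ [F ->] FC0.
  (* The degeneracy equation, conjugated by [V]; its diagonal entries [F 0 i * Cy i i] then force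
     [F = 0]. *)
  have : diag_mx F *m Cy = 0.
    rewrite /Cy covmx_gft//.
    have -> : diag_mx F *m (V^T *m covmx P y y *m V) =
        V^T *m (V *m diag_mx F *m V^T *m covmx P y y) *m V.
      by rewrite !mulmxA VTV mul1mx.
    by rewrite FC0 mulmx0 mul0mx.
  clearbody Cy => /matrixP FC; have -> : F = 0.
    apply/rowP => i; have := FC i i; rewrite mul_diag_mx !mxE => /eqP.
    by rewrite mulf_eq0 (negbTE (Dy_neq0 i)) orbF => /eqP.
  by rewrite linear0 mulmx0 mul0mx.
Qed.

Lemma gsp_lmmse_diag x y : L2 x -> L2 y ->
    covmx P y y \in unitmx -> gft_dcov P V y y \in unitmx ->
    is_diag_mx (covmx P (gft V \o x) (gft V \o y)) ->
    is_diag_mx (covmx P (gft V \o y) (gft V \o y)) ->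
  gsp_lmmse P V x y = lmmse P x y.
Proof.
move=> x2 y2 yU DU /is_diag_diagv dx /is_diag_diagv dy.
(* Diagonality identifies each spectral covariance with its diagonal part, so [V] carries it back to
   the vertex domain. *)
have Cy : V^T *m covmx P y y = gft_dcov P V y y *m V^T.
  by rewrite -[gft_dcov _ _ _ _]dy covmx_gft// -[RHS]mulmxA VVT mulmx1.
have Cx : V *m gft_dcov P V x y = covmx P x y *m V.
  by rewrite -[gft_dcov _ _ _ _]dx covmx_gft// !mulmxA VVT mul1mx.
apply/funext => u; rewrite /gsp_lmmse /lmmse; congr (_ + _ *m _).
(* It remains to see that the GSP gain times the covariance of [y] is the cross-covariance of [x]
   and [y]. *)
rewrite -[LHS](mulmxK yU); congr (_ *m _).
by rewrite -(mulmxA _ V^T) Cy mulmxA mulmxKV// Cx -(mulmxA _ V) VVT mulmx1.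
Qed.

End gsp.

(** * Coincidence of the estimators under C1, C2 and C3 *)

Theorem theorem2
  (d : measure_display) (T : measurableType d) (R : realType)
  (P : probability T R) (N : nat) (N_gt0 : (0 < N)%N)
  (W L V : 'M[R]_N) (lam : 'rV[R]_N)
  (graphW : weighted_graph W) (defL : L = laplacian W)
  (evdL : laplacian_evd L V lam)
  (g : 'M[R]_N -> 'cV[R]_N -> 'cV[R]_N)
  (mg : measurable_fun [set: 'M[R]_N * 'cV[R]_N] (fun p => g p.1 p.2))
  (x w : {RV P >-> 'cV[R]_N}) (y : T -> 'cV[R]_N)
  (model : forall t, y t = g L (x t) + w t)
  (w_mean0 : meanv P w = 0)
  (indep_xw : indep_pair P x w)
  (x_L2 : finite_second_moment P x)
  (w_L2 : finite_second_moment P w)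
  (g_L2 : finite_second_moment P (fun t => g L (x t)))
  (Cyy_unit : covmx P y y \in unitmx)
  (Dyy_unit : gft_dcov P V y y \in unitmx)
  (C1 : gsp_separable L V g)
  (C2 : mutually_indep P (coordv (gft V \o x)))
  (C3 : is_diag_mx (covmx P (gft V \o w) (gft V \o w))) :
  [/\ forall f, is_lmmse P x y f <-> f = lmmse P x y,
      forall f, is_gsp_lmmse P V x y f <-> f = gsp_lmmse P V x y
    & gsp_lmmse P V x y = lmmse P x y].
Proof.
have [VTV _ _] := evdL.
pose gx t := g L (x t).
have yE : y = fun t => gx t + w t by apply/funext.
have y_L2 : finite_second_moment P y.
  by rewrite yE; exact: finite_second_momentD.
have gft_L2 a : finite_second_moment P a -> finite_second_moment P (gft V \o a).
  by move=> a2; exact: finite_second_moment_mulmx.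
(* The scalar response at graph frequency [j]: by C1, coordinate [j] of the transformed measurement
   is [h j] of coordinate [j] of the transformed input. *)
pose h j s := gft V (g L (s *: col j V)) j 0.
have mgL : measurable_fun setT (g L).
  apply: (measurableT_comp mg (g := fun u => (L, u))).
  exact: measurable_fun_pair.
have mcoord j : measurable_fun setT (fun u : 'cV[R]_N => gft V u j 0).
  exact: measurable_mulmx_coord.
have mh j : measurable_fun setT (h j).
  apply: (measurableT_comp (mcoord j)); apply: (measurableT_comp mgL).
  apply: measurable_fun_mx => i k; under eq_fun do rewrite !mxE.
  exact: measurable_funM.
have gxE j : coordv (gft V \o gx) j = h j \o coordv (gft V \o x) j.
  by apply/funext => t; rewrite /coordv /= /gx C1.
have indep_x i j : i != j ->
    indep_pair P (coordv (gft V \o x) i) (coordv (gft V \o x) j).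
  by move=> ij; exact: mutually_indep_pair.
have xg0 : is_diag_mx (covmx P (gft V \o x) (gft V \o gx)).
  apply/is_diag_mxP => i j ij; rewrite mxE.
  rewrite covariance_indep//; try exact: gft_L2.
  (* For [i != j], coordinate [i] of the input is independent of coordinate [j], hence of its image
     under [h j]. *)
  by rewrite gxE; apply: (indep_pair_comp (f := id)) => //; exact: indep_x.
have gg0 : is_diag_mx (covmx P (gft V \o gx) (gft V \o gx)).
  apply/is_diag_mxP => i j ij; rewrite mxE.
  rewrite covariance_indep//; try exact: gft_L2.
  by rewrite !gxE; apply: indep_pair_comp => //; exact: indep_x.
have xw0 : covmx P (gft V \o x) (gft V \o w) = 0.
  apply/matrixP => i j; rewrite !mxE covariance_indep//; try exact: gft_L2.
  exact: indep_pair_comp (mcoord i) (mcoord j) indep_xw.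
(* Each coordinate here is a measurable function of all of [x], so independence of [x] and [w] kills
   every entry, diagonal ones included. *)
have gw0 : covmx P (gft V \o gx) (gft V \o w) = 0.
  apply/matrixP => i j; rewrite !mxE covariance_indep//; try exact: gft_L2.
  have mi := measurableT_comp (mcoord i) mgL.
  exact: (indep_pair_comp mi (mcoord j) indep_xw).
have ygE : gft V \o y = fun t => gft V (gx t) + gft V (w t).
  by apply/funext => t; rewrite yE /= /gft mulmxDr.
split; [exact: is_lmmseE|exact: is_gsp_lmmseE|apply: gsp_lmmse_diag => //].
- by rewrite ygE covmxDr ?xw0 ?addr0//; exact: gft_L2.
(* With the cross terms gone, the spectral covariance of [y] is that of the signal part, diagonal by
   C1 and C2, plus that of the noise, diagonal by C3. *)
- rewrite ygE covmx_sqrD; try exact: gft_L2.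
  rewrite gw0 trmx0 !addr0; apply/is_diag_mxP => i j ij.
  move/is_diag_mxP: C3 => ww; move/is_diag_mxP: gg0 => gg.
  by rewrite mxE gg// ww// addr0.
Qed.
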